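(* Let $\Bbbk:\mathbb{T}\times\mathbb{T}\to\mathbb{R}$ be a stable Mercer kernel with $\mu_0<\infty$ and RKHS $\mathscr{H}_{\Bbbk}$. Let $\mathrm{u}$ be a bounded input signal, $t_0,\dots,t_{n_{\mathscr{D}}-1}\in\mathbb{T}$ distinct measurement times with data $y_{t_0},\dots,y_{t_{n_{\mathscr{D}}-1}}\in\mathbb{R}$, $\lambda>0$, $\epsilon\in(0,1)$, and let $\mathscr{P}=\{\omega_0<\omega_1<\dots<\omega_{n_{\mathscr{P}}}\}$ be a partition of a compact interval contained in $\Omega_{\mathbb{T}}$. Let $m=n_{\mathscr{D}}+2n_{\mathscr{P}}+2$, let $\varphi_0,\dots,\varphi_{m-1}\in\mathscr{H}_{\Bbbk}$, $\Phi\in\mathbb{R}^{m\times m}$ and $\mathrm{a}_i,\mathrm{b}_j,\mathrm{c}_j\in\mathbb{R}^m$ be as defined in the context, and assume that $\varphi_0,\dots,\varphi_{m-1}$ are linearly independent. Then the unique solution $\mathrm{g}^{(\star,\epsilon)}$ of $$\min_{\mathrm{g}\in\mathscr{H}_{\Bbbk}}\ \sum_{i=0}^{n_{\mathscr{D}}-1}\big(\mathrm{L}^{\mathrm{u}}_{t_i}(\mathrm{g})-y_{t_i}\big)^2+\lambda\|\mathrm{g}\|_{\mathscr{H}_{\Bbbk}}^2\quad\text{s.t.}\quad|\mathcal{F}_\omega(\mathrm{g})|^2\le1-\epsilon\ \ \text{for all }\omega\in\mathscr{P}$$ is of the form $$\mathrm{g}^{(\star,\epsilon)}=\sum_{i=0}^{m-1}x_i\varphi_i,$$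 where $\mathrm{x}=(x_0,\dots,x_{m-1})^{\mathsf T}\in\mathbb{R}^m$ is the unique solution of the convex program $$\min_{\mathrm{x}\in\mathbb{R}^m}\ \sum_{i=0}^{n_{\mathscr{D}}-1}(\mathrm{a}_i^{\mathsf T}\mathrm{x}-y_{t_i})^2+\lambda\,\mathrm{x}^{\mathsf T}\Phi\mathrm{x}\quad\text{s.t.}\quad(\mathrm{b}_j^{\mathsf T}\mathrm{x})^2+(\mathrm{c}_j^{\mathsf T}\mathrm{x})^2\le1-\epsilon,\ \ j=0,\dots,n_{\mathscr{P}}.$$
   Context: $\mathbb{T}$ denotes either $\mathbb{Z}_+=\{0,1,2,\dots\}$ or $\mathbb{R}_+=[0,\infty)$. $\Omega_{\mathbb{T}}=[0,\pi]$ if $\mathbb{T}=\mathbb{Z}_+$ and $\Omega_{\mathbb{T}}=\mathbb{R}_+$ if $\mathbb{T}=\mathbb{R}_+$. A Mercer kernel is a continuous symmetric positive semidefinite function $\Bbbk:\mathbb{T}\times\mathbb{T}\to\mathbb{R}$; $\mathscr{H}_{\Bbbk}\subseteq\mathbb{R}^{\mathbb{T}}$ is its (real) RKHS. $\Bbbk$ is stable if $\mathscr{H}_{\Bbbk}\subseteq\ell^1(\mathbb{Z}_+)$ (resp. $L^1(\mathbb{R}_+)$). $\mu_0=\sum_{t\in\mathbb{Z}_+}\Bbbk(t,t)^{1/2}$ (resp. $\int_{\mathbb{R}_+}\Bbbk(t,t)^{1/2}\,dt$). The input $\mathrm{u}$ is in $\ell^\infty(\mathbb{Z})$ (resp. $L^\infty(\mathbb{R})$);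 $\mathrm{L}^{\mathrm{u}}_t(\mathrm{g})=\sum_{s\in\mathbb{Z}_+}g_su_{t-s}$ (resp. $\int_{\mathbb{R}_+}g_su_{t-s}\,ds$). $\mathcal{F}_\omega=\mathcal{F}^{(\mathrm{r})}_\omega+\mathrm{j}\mathcal{F}^{(\mathrm{i})}_\omega$ ($\mathrm{j}$ the imaginary unit) with $\mathcal{F}^{(\mathrm{r})}_\omega(\mathrm{g})=\sum_{t}g_t\cos(\omega t)$, $\mathcal{F}^{(\mathrm{i})}_\omega(\mathrm{g})=-\sum_{t}g_t\sin(\omega t)$ for $\mathbb{T}=\mathbb{Z}_+$, and the corresponding integrals over $\mathbb{R}_+$ for $\mathbb{T}=\mathbb{R}_+$. Since $\mu_0<\infty$, these are bounded linear functionals on $\mathscr{H}_{\Bbbk}$; let $\varphi^{(\mathrm{u})}_t,\varphi^{(\mathrm{r})}_\omega,\varphi^{(\mathrm{i})}_\omega\in\mathscr{H}_{\Bbbk}$ be the Riesz representers of $\mathrm{L}^{\mathrm{u}}_t,\mathcal{F}^{(\mathrm{r})}_\omega,\mathcal{F}^{(\mathrm{i})}_\omega$. Put $\varphi_i=\varphi^{(\mathrm{u})}_{t_i}$ for $0\le i\le n_{\mathscr{D}}-1$, and $\varphi_{n_{\mathscr{D}}+2j}=\varphi^{(\mathrm{r})}_{\omega_j}$, $\varphi_{n_{\mathscr{D}}+2j+1}=\varphi^{(\mathrm{i})}_{\omega_j}$ for $0\le j\le n_{\mathscr{P}}$. $\Phi$ is the Gram matrix whose $(i,j)$ entry is $\langle\varphi_{i-1},\varphi_{j-1}\rangle_{\mathscr{H}_{\Bbbk}}$,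 $i,j=1,\dots,m$; $\mathrm{a}_i$ is its $(i+1)$-th column for $0\le i\le n_{\mathscr{D}}-1$, and $\mathrm{b}_j$, $\mathrm{c}_j$ are its $(n_{\mathscr{D}}+2j+1)$-th and $(n_{\mathscr{D}}+2j+2)$-th columns for $0\le j\le n_{\mathscr{P}}$. A partition of $[a,b]$ is a finite set $\{\omega_0,\dots,\omega_n\}$ with $a=\omega_0<\dots<\omega_n=b$. *)

(* Defs.v *)
From HB Require Import structures.
From mathcomp Require Import all_boot all_order all_algebra.
From mathcomp Require Import all_classical all_reals all_analysis.
From mathcomp Require Import complex zify.

Set Implicit Arguments.
Unset Strict Implicit.
Unset Printing Implicit Defensive.

Import Order.TTheory GRing.Theory Num.Theory.
Import numFieldNormedType.Exports.

Local Open Scope classical_set_scope.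
Local Open Scope ring_scope.

Inductive time_kind := DiscreteTime | ContinuousTime.

Definition half_line (R : realType) : set R := `[0, +oo[%classic.
Arguments half_line : clear implicits.

(* nat carries its discrete topology, and the half-line the topology induced *)
(* by that of R.                                                             *)
Definition time_axis (R : realType) (T : time_kind) : topologicalType :=
  match T with
  | DiscreteTime => nat
  | ContinuousTime => set_type (half_line R)
  end.

(* The domain of inputs: Z or R *)
Definition time_line (R : realType) (T : time_kind) : zmodType :=
  match T with
  | DiscreteTime => int
  | ContinuousTime => (R : zmodType)
  end.

Definition time_emb (R : realType) (T : time_kind) :
    time_axis R T -> time_line R T :=
  match T with
  | DiscreteTime => fun t : nat => t%:Z
  | ContinuousTime => fun t : half_line R => set_val t
  end.

Definition time_val (R : realType) (T : time_kind) : time_axis R T -> R :=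
  match T with
  | DiscreteTime => fun t : nat => t%:R
  | ContinuousTime => fun t : half_line R => set_val t
  end.

Definition Omega (R : realType) (T : time_kind) : set R :=
  match T with
  | DiscreteTime => `[0, pi]%classic
  | ContinuousTime => half_line R
  end.
Arguments Omega : clear implicits.

(* A function on the half-line is extended by 0 to R, as required by         *)
(* lebesgue_measure; the extension plays no role in the integral.            *)
Definition time_sum (R : realType) (T : time_kind) :
    (time_axis R T -> R) -> R :=
  match T with
  | DiscreteTime => fun f : nat -> R => limn (series f)
  | ContinuousTime => fun f : half_line R -> R =>
      \int[lebesgue_measure]_(s in half_line R) 'valL_ 0 f s
  end.

Definition time_esum (R : realType) (T : time_kind) :
    (time_axis R T -> R) -> \bar R :=
  match T with
  | DiscreteTime => fun f : nat -> R => (\sum_(0 <= t <oo) (f t)%:E)%E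
  | ContinuousTime => fun f : half_line R -> R =>
      (\int[lebesgue_measure]_(s in half_line R) ('valL_ 0 f s)%:E)%E
  end.

(* l^1(nat), or L^1 of the half-line *)
Definition time_L1 (R : realType) (T : time_kind) : set (time_axis R T -> R) :=
  match T with
  | DiscreteTime => [set f : nat -> R | summable [set: nat] (EFin \o f)]
  | ContinuousTime => [set f : half_line R -> R |
      lebesgue_measure.-integrable (half_line R) (EFin \o 'valL_ 0 f)]
  end.
Arguments time_L1 : clear implicits.

(* l^oo(Z), or L^oo(R) through Borel measurable representatives *)
Definition bounded_input (R : realType) (T : time_kind) :
    set (time_line R T -> R) :=
  match T with
  | DiscreteTime => [set u : int -> R | bounded_fun u]
  | ContinuousTime => [set u : measurableTypeR R -> R |
      u \in Lfun (@lebesgue_measure R) +oo%E]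
  end.

(* The values of inner outside the underlying set of functions are           *)
(* unconstrained and irrelevant.                                             *)
Record hilbert_function_space (R : realType) (X : Type) :=
  HilbertFunctionSpace {
    hilbert_set :> (X -> R) -> Prop;
    inner : (X -> R) -> (X -> R) -> R;
    hilbert_set0 : hilbert_set (fun=> 0);
    hilbert_set_lin : forall (a : R) f g, hilbert_set f -> hilbert_set g ->
      hilbert_set (fun x => a * f x + g x);
    inner_sym : forall f g, hilbert_set f -> hilbert_set g ->
      inner f g = inner g f;
    inner_lin : forall (a : R) f g h,
      hilbert_set f -> hilbert_set g -> hilbert_set h ->
      inner (fun x => a * f x + g x) h = a * inner f h + inner g h;
    inner_ge0 : forall f, hilbert_set f -> 0 <= inner f f;
    inner_eq0 : forall f, hilbert_set f -> inner f f = 0 -> f = (fun=> 0);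
    hilbert_complete : forall F : nat -> X -> R,
      (forall n, hilbert_set (F n)) ->
      (forall e : R, 0 < e -> exists N : nat, forall m n : nat,
        (N <= m)%N -> (N <= n)%N ->
        Num.sqrt (inner (F m \- F n) (F m \- F n)) < e) ->
      exists2 f, hilbert_set f &
        (fun n => Num.sqrt (inner (F n \- f) (F n \- f))) @ \oo --> (0 : R)
  }.

Definition hnorm (R : realType) (X : Type) (H : hilbert_function_space R X)
  (f : X -> R) : R := Num.sqrt (inner H f f).

Record mercer_kernel (R : realType) (X : topologicalType) (k : X -> X -> R) :
    Prop := MercerKernel {
  mercer_continuous : continuous (fun xy : X * X => k xy.1 xy.2);
  mercer_sym : forall x y, k x y = k y x;
  mercer_psd : forall (n : nat) (x : 'I_n -> X) (c : 'I_n -> R),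
    0 <= \sum_(i < n) \sum_(j < n) c i * c j * k (x i) (x j)
}.

(* By the Moore-Aronszajn theorem every positive semidefinite k has exactly  *)
(* one such H.                                                               *)
Definition is_rkhs (R : realType) (X : Type) (k : X -> X -> R)
    (H : hilbert_function_space R X) : Prop :=
  (forall x, H (k x)) /\ (forall f, H f -> forall x, f x = inner H f (k x)).

Definition is_riesz_representer (R : realType) (X : Type)
    (H : hilbert_function_space R X) (L : (X -> R) -> R) (phi : X -> R) :
    Prop :=
  H phi /\ forall g, H g -> L g = inner H phi g.

Definition lin_comb (R : realType) (X : Type) (m : nat) (phi : 'I_m -> X -> R)
  (x : 'cV[R]_m) : X -> R := fun s => \sum_(i < m) x i 0 * phi i s.

Definition lin_independent (R : realType) (X : Type) (m : nat)
    (phi : 'I_m -> X -> R) : Prop :=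
  forall x : 'cV[R]_m, lin_comb phi x = (fun=> 0) -> x = 0.

Definition gram (R : realType) (X : Type) (H : hilbert_function_space R X)
  (m : nat) (phi : 'I_m -> X -> R) : 'M[R]_m :=
  \matrix_(i, j) inner H (phi i) (phi j).

Section Functionals.
Context (R : realType) (T : time_kind).
Implicit Types (k : time_axis R T -> time_axis R T -> R)
  (g : time_axis R T -> R).

Definition mu0 k : \bar R := time_esum (fun t => Num.sqrt (k t t)).

(* H stands for the kernel it is the reproducing kernel Hilbert space of. *)
Definition stable (H : hilbert_function_space R (time_axis R T)) : Prop :=
  forall g, H g -> time_L1 R T g.

Definition conv_at (u : time_line R T -> R) (t : time_axis R T) g : R :=
  time_sum (fun s => g s * u (time_emb t - time_emb s)).

Definition fourier_re (w : R) g : R :=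
  time_sum (fun t => g t * cos (w * time_val t)).

Definition fourier_im (w : R) g : R :=
  - time_sum (fun t => g t * sin (w * time_val t)).

Definition fourier (w : R) g : R[i] := (fourier_re w g +i* fourier_im w g)%C.

End Functionals.

Definition partition_of (R : realType) (a b : R) (n : nat)
    (w : 'I_n.+1 -> R) : Prop :=
  [/\ w ord0 = a, w ord_max = b &
      forall i j : 'I_n.+1, (i < j)%N -> w i < w j].

(* Positions in 'I_(nD + 2 * nP + 2) of the data indices i, and of the real  *)
(* and imaginary parts at the frequency indices j.                           *)
Section Indices.
Context (nD nP : nat).

Fact data_idx_proof (i : 'I_nD) : (i < nD + 2 * nP + 2)%N.
Proof. by rewrite -addnA ltn_addr. Qed.

Fact re_idx_proof (j : 'I_nP.+1) : (nD + 2 * j < nD + 2 * nP + 2)%N.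
Proof. by have := ltn_ord j; lia. Qed.

Fact im_idx_proof (j : 'I_nP.+1) : (nD + 2 * j + 1 < nD + 2 * nP + 2)%N.
Proof. by have := ltn_ord j; lia. Qed.

Definition data_idx (i : 'I_nD) := Ordinal (data_idx_proof i).
Definition re_idx (j : 'I_nP.+1) := Ordinal (re_idx_proof j).
Definition im_idx (j : 'I_nP.+1) := Ordinal (im_idx_proof j).

End Indices.

Definition representer_family (R : realType) (T : time_kind)
    (H : hilbert_function_space R (time_axis R T))
    (u : time_line R T -> R) (nD nP : nat)
    (t : 'I_nD -> time_axis R T) (w : 'I_nP.+1 -> R)
    (phi : 'I_(nD + 2 * nP + 2) -> time_axis R T -> R) : Prop :=
  [/\ forall i, is_riesz_representer H (conv_at u (t i)) (phi (data_idx nP i)),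
      forall j, is_riesz_representer H (@fourier_re R T (w j))
        (phi (re_idx nD j)) &
      forall j, is_riesz_representer H (@fourier_im R T (w j))
        (phi (im_idx nD j))].

Section Optimization.
Context (R : realType) (X : Type).
Implicit Types (F : set X) (J : X -> R) (x : X).

Definition solves F J x : Prop := F x /\ forall z, F z -> J x <= J z.

Definition unique_solution F J x : Prop :=
  solves F J x /\ forall z, solves F J z -> z = x.

End Optimization.

Definition convex_program (R : realType) (E : lmodType R) (F : set E)
    (J : E -> R) : Prop :=
  convex_set (F : set (convex_lmodType E)) /\
  convex_function [set: convex_lmodType E] (J : convex_lmodType E -> R^o).

Section Problems.
Context (R : realType) (T : time_kind)
  (H : hilbert_function_space R (time_axis R T)) (u : time_line R T -> R)
  (nD nP : nat) (t : 'I_nD -> time_axis R T) (y : 'I_nD -> R)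
  (w : 'I_nP.+1 -> R) (lambda eps : R).

Definition hilbert_cost (g : time_axis R T -> R) : R :=
  \sum_(i < nD) (conv_at u (t i) g - y i) ^+ 2 + lambda * hnorm H g ^+ 2.

Definition hilbert_feasible : set (time_axis R T -> R) :=
  [set g | H g /\ forall j, `|fourier (w j) g| ^+ 2 <= (1 - eps)%:C%C].

Context (Phi : 'M[R]_(nD + 2 * nP + 2)).

Let a (i : 'I_nD) := col (data_idx nP i) Phi.
Let b (j : 'I_nP.+1) := col (re_idx nD j) Phi.
Let c (j : 'I_nP.+1) := col (im_idx nD j) Phi.

(* The 1 x 1 products are turned into scalars by selecting their only entry. *)
Definition finite_cost (x : 'cV[R]_(nD + 2 * nP + 2)) : R :=
  \sum_(i < nD) (((a i)^T *m x) 0 0 - y i) ^+ 2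
  + lambda * (x^T *m Phi *m x) 0 0.

Definition finite_feasible : set 'cV[R]_(nD + 2 * nP + 2) :=
  [set x | forall j,
    ((b j)^T *m x) 0 0 ^+ 2 + ((c j)^T *m x) 0 0 ^+ 2 <= 1 - eps].

End Problems.

(* Main.v *)
Require Import Defs.
From HB Require Import structures.
From mathcomp Require Import all_boot all_order all_algebra.
From mathcomp Require Import all_classical all_reals all_analysis.
From mathcomp Require Import complex.
From mathcomp Require Import ring lra zify.

Set Implicit Arguments.
Unset Strict Implicit.
Unset Printing Implicit Defensive.

Import Order.TTheory GRing.Theory Num.Theory.
Import numFieldNormedType.Exports.

Local Open Scope classical_set_scope.
Local Open Scope ring_scope.

(** Boundedness of the input and finiteness of [mu0] serve to make the
    convolution and Fourier functionals bounded on the Hilbert space.  Once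
    their Riesz representers [phi i] are given, the theorem is Hilbert-space
    geometry: both the data misfit and the frequency constraints see a function
    [g] only through the vector [evals g] of the inner products
    [inner H (phi i) g], so the problem is to minimize
    [Q (evals g) + lambda * inner H g g] subject to [A (evals g)], with [A] a
    convex closed set and [Q] a convex continuous function on the column
    vectors.

    Existence and uniqueness.  The squared norm satisfies
    [|t f + (1 - t) g|^2 = t |f|^2 + (1 - t) |g|^2 - t (1 - t) |f - g|^2]
    ([inner_conv]), so the cost is strongly convex.  At [t = 1/2] this bounds
    the squared distance of two nearly optimal functions by their
    suboptimality.  A minimizing sequence is therefore Cauchy, its limit is a
    minimizer, and two minimizers coincide ([strongly_convex_unique_min]).

    Reduction to coefficients.  As the [phi i] are independent, their Gram
    matrix is invertible ([gram_unit]), and every [g] splits into a combination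
    of the [phi i] plus a remainder orthogonal to all of them.  Removing the
    remainder changes neither constraints nor misfit and lowers the penalty by
    [lambda] times the squared norm of the remainder
    ([reg_cost_decomposition]), so the minimizer is a combination
    [lin_comb phi x].  On combinations, cost and constraints are those of the
    finite program, because [evals (lin_comb phi x) = Phi *m x] and
    [inner H (lin_comb phi x) (lin_comb phi x) = x^T Phi x]; as [lin_comb phi]
    is injective, the two problems have corresponding unique solutions
    ([representer_theorem]). *)

(** * Geometry and convergence in a Hilbert function space *)

Section HilbertFunctionSpace.
Context (R : realType) (X : Type) (H : hilbert_function_space R X).
Implicit Types (f g h : X -> R) (a t : R).

Lemma hilbert_setZ a f : H f -> H (a *: f).
Proof.
move=> Hf; have := hilbert_set_lin a Hf (hilbert_set0 H).
by congr (hilbert_set H _); apply/funext => x; rewrite addr0.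
Qed.

Lemma hilbert_setD f g : H f -> H g -> H (f + g).
Proof.
move=> Hf Hg; have := hilbert_set_lin 1 Hf Hg.
by congr (hilbert_set H _); apply/funext => x; rewrite mul1r.
Qed.

Lemma hilbert_setB f g : H f -> H g -> H (f - g).
Proof.
by move=> Hf Hg; rewrite -scaleN1r; apply/hilbert_setD/hilbert_setZ.
Qed.

Lemma hilbert_set_sum n (F : 'I_n -> X -> R) :
  (forall i, H (F i)) -> H (\sum_i F i).
Proof.
move=> HF; elim/big_ind : _ => //; first exact: hilbert_set0.
exact: hilbert_setD.
Qed.

#[local] Hint Resolve hilbert_setZ hilbert_setD hilbert_setB : core.
#[local] Hint Resolve hilbert_set_sum : core.

Lemma innerDl f g h : H f -> H g -> H h ->
  inner H (f + g) h = inner H f h + inner H g h.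
Proof.
move=> Hf Hg Hh; rewrite -[inner H f h]mul1r -inner_lin //.
by congr (inner H _ _); apply/funext => x; rewrite mul1r.
Qed.

Lemma inner0l h : H h -> inner H 0 h = 0.
Proof.
move=> Hh; apply: (addrI (inner H 0 h)); rewrite -innerDl ?addr0 //.
all: exact: hilbert_set0.
Qed.

Lemma innerZl a f h : H f -> H h -> inner H (a *: f) h = a * inner H f h.
Proof.
move=> Hf Hh; have H0 : H 0 by exact: hilbert_set0.
rewrite -[RHS]addr0 -(inner0l Hh) -inner_lin //.
by congr (inner H _ _); apply/funext => x; rewrite addr0.
Qed.

Lemma innerBl f g h : H f -> H g -> H h ->
  inner H (f - g) h = inner H f h - inner H g h.
Proof.
by move=> *; rewrite -scaleN1r innerDl ?innerZl ?mulN1r //; exact: hilbert_setZ.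
Qed.

Lemma inner_suml n (F : 'I_n -> X -> R) h : (forall i, H (F i)) -> H h ->
  inner H (\sum_i F i) h = \sum_i inner H (F i) h.
Proof.
move=> HF Hh.
have [] : H (\sum_i F i) /\
    inner H (\sum_i F i) h = \sum_i inner H (F i) h; last by [].
elim/big_ind2 : _ => [|f a g b [Hf <-] [Hg <-]|//].
  by split; [exact: hilbert_set0 | exact: inner0l].
by split; [exact: hilbert_setD | exact: innerDl].
Qed.

Lemma innerDr f g h : H f -> H g -> H h ->
  inner H h (f + g) = inner H h f + inner H h g.
Proof.
move=> Hf Hg Hh; rewrite (inner_sym Hh Hf) (inner_sym Hh Hg) -innerDl //.
by rewrite inner_sym; auto.
Qed.

Lemma innerZr a f h : H f -> H h -> inner H h (a *: f) = a * inner H h f.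
Proof.
by move=> Hf Hh; rewrite (inner_sym Hh Hf) -innerZl // inner_sym; auto.
Qed.

Lemma innerBr f g h : H f -> H g -> H h ->
  inner H h (f - g) = inner H h f - inner H h g.
Proof.
move=> Hf Hg Hh; rewrite (inner_sym Hh Hf) (inner_sym Hh Hg) -innerBl //.
by rewrite inner_sym; auto.
Qed.

Lemma hnorm_sqr f : H f -> hnorm H f ^+ 2 = inner H f f.
Proof. by move=> Hf; rewrite sqr_sqrtr ?inner_ge0. Qed.

(** Positivity of the square of [<f, f> g - <f, g> f]; this vector avoids
    dividing by [<f, f>]. *)
Lemma cauchy_schwarz f g : H f -> H g ->
  `|inner H f g| <= hnorm H f * hnorm H g.
Proof.
move=> Hf Hg; rewrite -sqrtrM ?inner_ge0 // -sqrtr_sqr ler_wsqrtr //.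
have := inner_ge0 Hf; rewrite le_eqVlt => /orP[/eqP/esym f0|f_gt0].
  by rewrite f0 (inner_eq0 Hf f0) inner0l // expr0n mul0r.
have := inner_ge0 (hilbert_setB (hilbert_setZ (inner H f f) Hg)
                                (hilbert_setZ (inner H f g) Hf)).
rewrite !(innerBl, innerBr, innerZl, innerZr) //; [|by auto ..].
rewrite (inner_sym Hg Hf) => h.
rewrite -subr_ge0 -(pmulr_rge0 _ f_gt0).
by congr (0 <= _): h; ring.
Qed.

(** The deficit in the convexity inequality of the squared norm is an explicit
    multiple of [|f - g|^2]: this is what makes the regularized cost strongly
    convex, whatever convex misfit is added to it. *)
Lemma inner_conv t f g : H f -> H g ->
  let h := t *: f + (1 - t) *: g in
  inner H h h = t * inner H f f + (1 - t) * inner H g g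
                - t * (1 - t) * inner H (f - g) (f - g).
Proof.
move=> Hf Hg /=.
rewrite !(innerBl, innerBr, innerDl, innerDr, innerZl, innerZr) //;
  [|by auto ..].
by rewrite (inner_sym Hg Hf); ring.
Qed.

Lemma inner_pythagoras f g : H f -> H g -> inner H f g = 0 ->
  inner H (f + g) (f + g) = inner H f f + inner H g g.
Proof.
move=> Hf Hg fg0; rewrite !(innerDl, innerDr) //; [|by auto ..].
by rewrite (inner_sym Hg Hf) fg0; ring.
Qed.

Definition hilbert_cvg (F : nat -> X -> R) f :=
  (fun n => hnorm H (F n - f)) @ \oo --> (0 : R).

Lemma cvg_inner (F : nat -> X -> R) f h : (forall n, H (F n)) -> H f -> H h ->
  hilbert_cvg F f -> (fun n => inner H h (F n)) @ \oo --> inner H h f.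
Proof.
move=> HF Hf Hh cF; apply/subr_cvg0.
rewrite -(_ : (fun n => inner H h (F n - f)) =
              (fun n => inner H h (F n) - inner H h f)); last first.
  by apply/funext => n; rewrite innerBr.
apply: norm_cvg0.
apply: (@squeeze_cvgr _ _ _ _ (fun=> 0)
          (fun n => hnorm H h * hnorm H (F n - f))).
- by near=> n; rewrite normr_ge0 cauchy_schwarz //; auto.
- exact: cvg_cst.
- rewrite -[X in _ --> X](mulr0 (hnorm H h)).
  by apply: cvgM => //; exact: cvg_cst.
Unshelve. all: by end_near. Qed.

(** Expanding [|F n - f|^2] expresses [|F n|^2] through [|F n - f|] and
    [<f, F n>], whose limits are known. *)
Lemma cvg_inner_diag (F : nat -> X -> R) f : (forall n, H (F n)) -> H f ->
  hilbert_cvg F f -> (fun n => inner H (F n) (F n)) @ \oo --> inner H f f.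
Proof.
move=> HF Hf cF.
rewrite (_ : (fun n => _) = fun n =>
   hnorm H (F n - f) * hnorm H (F n - f) + 2 * inner H f (F n) - inner H f f).
  rewrite [X in _ --> X](_ : _ = 0 * 0 + 2 * inner H f f - inner H f f);
    last by ring.
  apply: cvgB; last exact: cvg_cst.
  apply: cvgD; first exact: cvgM.
  by apply: cvgM; [exact: cvg_cst|exact: cvg_inner].
apply/funext => n; rewrite -expr2 hnorm_sqr; last by auto.
rewrite !(innerBl, innerBr) //; [|by auto ..].
by rewrite (inner_sym Hf (HF n)); ring.
Qed.

(** Strong convexity at midpoints takes the place of compactness: it makes a
    minimizing sequence Cauchy, and completeness of the space provides its
    limit.  The last hypothesis says that [C] is sequentially closed and that
    [J] is sequentially continuous on it. *)
Lemma strongly_convex_unique_min (C : set (X -> R)) (J : (X -> R) -> R) mu :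
  C `<=` H -> C !=set0 -> 0 < mu ->
  (forall g, C g -> 0 <= J g) ->
  (forall f g, C f -> C g ->
    let h := 2^-1 *: f + (1 - 2^-1) *: g in
    C h /\ J h <= (J f + J g) / 2 - mu * inner H (f - g) (f - g)) ->
  (forall F f, (forall n, C (F n)) -> H f -> hilbert_cvg F f ->
    C f /\ (J \o F) @ \oo --> J f) ->
  exists g, unique_solution C J g.
Proof.
move=> CH [g0 Cg0] mu_gt0 J_ge0 cvx cont.
have lbJ : has_inf (J @` C).
  split; first by exists (J g0), g0.
  by exists 0 => _ [g Cg <-]; exact: J_ge0.
pose v := inf (J @` C).
have vJ g : C g -> v <= J g.
  by move=> Cg; apply: ge_inf; [exact: lbJ.2|exists g].
have /choice[F HF] n : exists g, C g /\ J g < v + n.+1%:R^-1.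
  have [|_ [g Cg <-] Jg] := @inf_adherent _ (J @` C) n.+1%:R^-1 _ lbJ.
    by rewrite invr_gt0.
  by exists g.
have CF n := (HF n).1; have JF n := (HF n).2.
have cauchyF (e : R) : 0 < e -> exists N : nat, forall m n : nat,
    (N <= m)%N -> (N <= n)%N ->
    Num.sqrt (inner H (F m \- F n) (F m \- F n)) < e.
  (* If both costs are within [mu * e ^+ 2] of [v], so is their mean; the
     midpoint costs at least [v], which leaves less than [mu * e ^+ 2] for
     [mu * |F m - F n|^2]. *)
  move=> e_gt0; have me_gt0 : 0 < mu * e ^+ 2 by rewrite mulr_gt0 ?exprn_gt0.
  have [N _ HN] := near_infty_natSinv_lt (PosNum me_gt0).
  exists N => m n /HN/= mN /HN/= nN.
  rewrite -[ltRHS](ger0_norm (ltW e_gt0)) -sqrtr_sqr ltr_sqrt ?exprn_gt0 //.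
  have [/vJ vh Jh] := cvx _ _ (CF m) (CF n).
  rewrite -(ltr_pM2l mu_gt0).
  have := JF m; have := JF n; have : v <= _ := le_trans vh Jh.
  move: mN nN; rewrite -[F m \- F n]/(F m - F n).
  move: (J (F m)) (J (F n)) (inner H _ _) m.+1%:R^-1 n.+1%:R^-1.
  clear; move: (e ^+ 2) => e2 jm jn d im jn'; lra.
have [f Hf cF] := hilbert_complete (fun n => CH _ (CF n)) cauchyF.
have [Cf JFf] := cont F f CF Hf cF.
have Jfv : J f <= v.
  apply: (ler_cvg_to JFf (g := fun n => v + n.+1%:R^-1)).
    rewrite -[X in _ --> X](addr0 v); apply: cvgD; first exact: cvg_cst.
    exact: cvg_harmonic.
  by near=> n; exact: ltW (JF n).
exists f; split; first by split=> // z Cz; exact: le_trans Jfv (vJ _ Cz).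
move=> z [Cz Jz].
have [/vJ vh Jh] := cvx _ _ Cz Cf.
have Hzf : H (z - f) by apply: hilbert_setB => //; exact: CH.
have /inner_eq0 zf : inner H (z - f) (z - f) = 0.
  apply/eqP; rewrite eq_le inner_ge0 // andbT -(pmulr_rle0 _ mu_gt0).
  have := Jz _ Cf; have := le_trans vh Jh; lra.
by apply/eqP; rewrite -subr_eq0; apply/eqP; exact: zf.
Unshelve. all: by end_near. Qed.

End HilbertFunctionSpace.

#[local] Hint Resolve hilbert_setZ hilbert_setD hilbert_setB : core.

(** * Regularized problems seen through finitely many inner products *)

Section RepresenterTheorem.
Context (R : realType) (X : Type) (H : hilbert_function_space R X).
Context (m : nat) (phi : 'I_m -> X -> R).
Hypothesis Hphi : forall i, H (phi i).
Implicit Types (f g : X -> R) (x z : 'cV[R]_m).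

#[local] Hint Resolve Hphi : core.

Local Notation Phi := (gram H phi).

Lemma lin_combE x : lin_comb phi x = \sum_i x i 0 *: phi i.
Proof. by rewrite fct_sumE. Qed.

Lemma hilbert_set_lin_comb x : H (lin_comb phi x).
Proof. by rewrite lin_combE; apply: hilbert_set_sum => i; auto. Qed.

#[local] Hint Resolve hilbert_set_lin_comb : core.

Lemma lin_combD x z : lin_comb phi (x + z) = lin_comb phi x + lin_comb phi z.
Proof.
rewrite !lin_combE -big_split; apply: eq_bigr => i _.
by rewrite mxE scalerDl.
Qed.

Lemma lin_combZ a x : lin_comb phi (a *: x) = a *: lin_comb phi x.
Proof.
by rewrite !lin_combE scaler_sumr; apply: eq_bigr => i _; rewrite mxE scalerA.
Qed.

(** By the Riesz property these are the values at [g] of the functionals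
    represented by the [phi i]. *)
Definition evals g : 'cV[R]_m := \col_i inner H (phi i) g.

Lemma evals_conv (t : R) f g : H f -> H g ->
  evals (t *: f + (1 - t) *: g) = t *: evals f + (1 - t) *: evals g.
Proof.
move=> Hf Hg; apply/colP => i; rewrite !mxE innerDr ?innerZr //; auto.
Qed.

Lemma evals_lin_comb x : evals (lin_comb phi x) = Phi *m x.
Proof.
apply/colP => i; rewrite !mxE lin_combE inner_sym //; last first.
  by rewrite -lin_combE.
rewrite inner_suml //; last by auto.
apply: eq_bigr => j _.
by rewrite mxE innerZl // mulrC inner_sym.
Qed.

Lemma inner_lin_comb x g : H g ->
  inner H (lin_comb phi x) g = (x^T *m evals g) 0 0.
Proof.
move=> Hg; rewrite lin_combE inner_suml //; last by auto.
by rewrite mxE; apply: eq_bigr => i _; rewrite innerZl // !mxE.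
Qed.

Lemma gram_quad x :
  (x^T *m Phi *m x) 0 0 = inner H (lin_comb phi x) (lin_comb phi x).
Proof. by rewrite inner_lin_comb // evals_lin_comb mulmxA. Qed.

Lemma tr_gram : Phi^T = Phi.
Proof. by apply/matrixP => i j; rewrite !mxE inner_sym. Qed.

Section Problem.
Context (A : set 'cV[R]_m) (Q : 'cV[R]_m -> R) (lambda : R).

Definition reg_feasible : set (X -> R) := [set g | H g /\ A (evals g)].
Definition reg_cost g : R := Q (evals g) + lambda * inner H g g.

(** The regularized problem restricted to combinations [lin_comb phi x] and
    written in the coefficients [x]. *)
Definition coef_feasible : set 'cV[R]_m := [set x | A (Phi *m x)].
Definition coef_cost x : R := Q (Phi *m x) + lambda * (x^T *m Phi *m x) 0 0.

Lemma reg_feasible_lin_comb x :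
  reg_feasible (lin_comb phi x) <-> coef_feasible x.
Proof.
by rewrite /reg_feasible /coef_feasible /= evals_lin_comb; split=> [[]|].
Qed.

Lemma reg_cost_lin_comb x : reg_cost (lin_comb phi x) = coef_cost x.
Proof. by rewrite /reg_cost /coef_cost evals_lin_comb gram_quad. Qed.

Lemma reg_feasible_convex (t : {i01 R}) f g : convex_program A Q ->
  reg_feasible f -> reg_feasible g ->
  reg_feasible (t%:num *: f + (1 - t%:num) *: g).
Proof.
move=> [cA _] [Hf Af] [Hg Ag]; split; first by auto.
rewrite evals_conv //; apply/set_mem.
by apply: (cA (evals f) (evals g) t); apply/mem_set.
Qed.

Lemma reg_cost_convex (t : {i01 R}) f g : convex_program A Q -> H f -> H g ->
  reg_cost (t%:num *: f + (1 - t%:num) *: g) <=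
  t%:num * reg_cost f + (1 - t%:num) * reg_cost g
  - lambda * (t%:num * (1 - t%:num)) * inner H (f - g) (f - g).
Proof.
move=> [_ cQ] Hf Hg; rewrite /reg_cost evals_conv // inner_conv //.
have := cQ t (evals f) (evals g) (mem_set I) (mem_set I).
rewrite -[conv t _ _]/(t%:num *: evals f + (1 - t%:num) *: evals g) => h.
rewrite -[conv t _ _]/(t%:num * Q (evals f) + (1 - t%:num) * Q (evals g)) in h.
move: h; set q := Q _; lra.
Qed.

(** Convexity is inherited from the function space, since [lin_comb phi] is
    linear. *)
Lemma coef_program_convex : 0 <= lambda ->
  convex_program A Q -> convex_program coef_feasible coef_cost.
Proof.
move=> l_ge0 cAQ; split.
  move=> x z t /set_mem/reg_feasible_lin_comb Cx.
  move=> /set_mem/reg_feasible_lin_comb Cz.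
  apply/mem_set/reg_feasible_lin_comb.
  rewrite -[conv t _ _]/(t%:num *: x + (1 - t%:num) *: z) lin_combD !lin_combZ.
  exact: reg_feasible_convex.
move=> t x z _ _.
rewrite -[conv t x z]/(t%:num *: x + (1 - t%:num) *: z).
rewrite -[conv t _ _]/(t%:num * coef_cost x + (1 - t%:num) * coef_cost z).
rewrite -!reg_cost_lin_comb lin_combD !lin_combZ.
apply: le_trans (reg_cost_convex t _ _ _) _ => //.
rewrite gerBl !mulr_ge0 ?inner_ge0 ?subr_ge0 //; auto.
Qed.

(** Closedness of [A] and continuity of [Q] are asked for entrywise convergence
    of vectors: convergence in norm in [H] gives convergence of each entry of
    [evals].  The condition [A 0] makes the zero function feasible. *)
Lemma reg_unique_solution : 0 < lambda -> convex_program A Q -> A 0 ->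
  (forall v, 0 <= Q v) ->
  (forall (V : nat -> 'cV[R]_m) (v : 'cV[R]_m),
    (forall i, (fun n => V n i 0) @ \oo --> v i 0) ->
    ((forall n, A (V n)) -> A v) /\ (Q \o V) @ \oo --> Q v) ->
  exists g, unique_solution reg_feasible reg_cost g.
Proof.
move=> l_gt0 cAQ A0 Q_ge0 cont.
(* The modulus is [lambda * (t * (1 - t))] at the midpoint [t = 1/2]. *)
apply: (@strongly_convex_unique_min _ _ H _ _ (lambda / 4)).
- by move=> g [].
- exists 0; split; first exact: hilbert_set0.
  congr A: A0; apply/colP => i; rewrite !mxE inner_sym ?inner0l //.
  exact: hilbert_set0.
- by rewrite divr_gt0.
- move=> g [Hg _]; rewrite addr_ge0 // mulr_ge0 ?inner_ge0 // ltW //.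
- have half_ge0 : 0 <= 2^-1 :> R by rewrite invr_ge0.
  have half_le1 : 2^-1 <= 1 :> R by rewrite invf_le1 ?ler1n.
  pose half := Itv01 half_ge0 half_le1.
  move=> f g Cf Cg h; have := reg_feasible_convex half cAQ Cf Cg.
  have := reg_cost_convex half cAQ Cf.1 Cg.1 => /= Jh Ch.
  split=> //; apply: le_trans Jh _.
  by rewrite le_eqVlt; apply/orP; left; apply/eqP; field.
- move=> F f CF Hf cF.
  have [] := cont (evals \o F) (evals f).
    move=> i; rewrite mxE.
    rewrite (_ : (fun n => _) = fun n => inner H (phi i) (F n)).
      by apply: cvg_inner => // n; have [] := CF n.
    by apply/funext => n; rewrite mxE.
  move=> clA cQ; split; first by split=> //; apply: clA => n; have [] := CF n.
  apply: cvgD => //; apply: cvgM; first exact: cvg_cst.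
  by apply: cvg_inner_diag => // n; have [] := CF n.
Qed.

Hypothesis phi_indep : lin_independent phi.

(** A vector [x] in the kernel of the Gram matrix gives a combination of squared
    norm [x^T Phi x = 0], which is then the zero function. *)
Lemma gram_unit : Phi \in unitmx.
Proof.
rewrite -unitmx_tr -row_free_unit -kermx_eq0; apply/rowV0P => v /sub_kermxP.
rewrite tr_gram => vPhi.
suff : v^T = 0 by move/(congr1 trmx); rewrite trmxK trmx0.
apply: phi_indep; apply: (@inner_eq0 _ _ H) => //.
by rewrite -gram_quad trmxK vPhi mul0mx mxE.
Qed.

Lemma lin_comb_inj : injective (lin_comb phi).
Proof.
move=> x z xz; apply/eqP; rewrite -subr_eq0; apply/eqP/phi_indep.
by rewrite -scaleN1r lin_combD lin_combZ scaleN1r xz subrr.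
Qed.

(** The coefficients of the orthogonal projection onto the span of the [phi i]
    solve the normal equations [Phi *m x = evals g]. *)
Lemma orthogonal_decomposition g : H g ->
  exists x, evals (g - lin_comb phi x) = 0.
Proof.
move=> Hg; exists (invmx Phi *m evals g).
transitivity (evals g - evals (lin_comb phi (invmx Phi *m evals g))).
  by apply/colP => i; rewrite !mxE innerBr.
by rewrite evals_lin_comb mulmxA mulmxV ?gram_unit // mul1mx subrr.
Qed.

Lemma reg_cost_decomposition g : H g -> exists x,
  evals (lin_comb phi x) = evals g /\
  reg_cost g = coef_cost x +
    lambda * inner H (g - lin_comb phi x) (g - lin_comb phi x).
Proof.
move=> Hg; have [x r0] := orthogonal_decomposition Hg; exists x.
have Hr : H (g - lin_comb phi x) by auto.
have ex : evals (lin_comb phi x) = evals g.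
  apply/colP => i; move/colP/(_ i) : r0; rewrite !mxE innerBr //.
  by move/eqP; rewrite subr_eq0 => /eqP.
split=> //; rewrite -reg_cost_lin_comb /reg_cost ex -addrA -mulrDr.
rewrite -inner_pythagoras ?inner_lin_comb ?r0 ?mulmx0 ?mxE //.
by rewrite (addrC (lin_comb phi x)) subrK.
Qed.

(** A minimizer has no component orthogonal to the [phi i], since dropping it
    would keep the function feasible and strictly decrease the cost.  Conversely
    a minimizer of the coefficient problem has the same cost as [g], so
    uniqueness in the function space gives uniqueness of the coefficients. *)
Lemma representer_theorem g : 0 < lambda ->
  unique_solution reg_feasible reg_cost g ->
  exists x, unique_solution coef_feasible coef_cost x /\ g = lin_comb phi x.
Proof.
move=> l_gt0 [[[Hg Ag] Jg] g_uniq].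
have [x [ex Jx]] := reg_cost_decomposition Hg.
have Cx : reg_feasible (lin_comb phi x) by split=> //; rewrite ex.
have gx : g = lin_comb phi x.
  have /inner_eq0 r0 : inner H (g - lin_comb phi x) (g - lin_comb phi x) = 0.
    apply/eqP; rewrite eq_le inner_ge0 ?andbT; last by auto.
    by rewrite -(pmulr_rle0 _ l_gt0) -(gerDl (coef_cost x)) -Jx
               -reg_cost_lin_comb Jg.
  by apply/eqP; rewrite -subr_eq0; apply/eqP/r0; auto.
exists x; split=> //; split; first split.
- exact/reg_feasible_lin_comb.
- move=> z /reg_feasible_lin_comb Cz.
  by rewrite -!reg_cost_lin_comb -gx; exact: Jg.
move=> z [/reg_feasible_lin_comb Cz Jz]; apply: lin_comb_inj.
rewrite -gx; apply: g_uniq; split=> // f Cf; apply: le_trans (Jg _ Cf).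
by rewrite gx !reg_cost_lin_comb; apply: Jz; exact/reg_feasible_lin_comb.
Qed.

End Problem.
End RepresenterTheorem.

(** * Least-squares misfit and frequency constraints *)

Section DataFitProgram.
Context (R : realType) (nD nP : nat) (y : 'I_nD -> R) (c : R).

Definition spectral_bound : set 'cV[R]_(nD + 2 * nP + 2) :=
  [set v | forall j : 'I_nP.+1,
    v (re_idx nD j) 0 ^+ 2 + v (im_idx nD j) 0 ^+ 2 <= c].

Definition data_misfit (v : 'cV[R]_(nD + 2 * nP + 2)) : R :=
  \sum_(i < nD) (v (data_idx nP i) 0 - y i) ^+ 2.

Lemma sqr_conv_le (t : {i01 R}) (a b : R) :
  (t%:num * a + (1 - t%:num) * b) ^+ 2 <=
  t%:num * a ^+ 2 + (1 - t%:num) * b ^+ 2.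
Proof.
have t_ge0 : 0 <= t%:num :> R by [].
have t_le1 : 0 <= 1 - t%:num :> R by rewrite subr_ge0.
rewrite -subr_ge0 (_ : _ - _ = t%:num * (1 - t%:num) * (a - b) ^+ 2).
  by apply: mulr_ge0; [exact: mulr_ge0|exact: sqr_ge0].
ring.
Qed.

Lemma data_fit_program_convex : convex_program spectral_bound data_misfit.
Proof.
split.
  move=> v z t /set_mem Av /set_mem Az; apply/mem_set => j.
  rewrite -[conv t _ _]/(t%:num *: v + (1 - t%:num) *: z) !mxE.
  apply: le_trans (lerD (sqr_conv_le t _ _) (sqr_conv_le t _ _)) _.
  have t_ge0 : 0 <= t%:num :> R by [].
  have t_le1 : 0 <= 1 - t%:num :> R by rewrite subr_ge0.
  have := lerD (ler_wpM2l t_ge0 (Av j)) (ler_wpM2l t_le1 (Az j)).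
  rewrite -mulrDl (addrC t%:num) subrK mul1r; apply: le_trans.
  by rewrite le_eqVlt; apply/orP; left; apply/eqP; ring.
move=> t v z _ _.
rewrite -[conv t v z]/(t%:num *: v + (1 - t%:num) *: z).
rewrite -[conv t _ _]/(t%:num * data_misfit v + (1 - t%:num) * data_misfit z).
rewrite !mulr_sumr -big_split; apply: ler_sum => i _ /=.
apply: le_trans (sqr_conv_le t _ _); rewrite !mxE.
by rewrite le_eqVlt; apply/orP; left; apply/eqP; congr (_ ^+ 2); ring.
Qed.

Lemma cvg_sqr (F : nat -> R) (l : R) : F @ \oo --> l ->
  (fun n => F n ^+ 2) @ \oo --> l ^+ 2.
Proof. by move=> cF; exact: cvgM. Qed.

Lemma data_fit_program_closed (V : nat -> 'cV[R]_(nD + 2 * nP + 2))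
    (v : 'cV[R]_(nD + 2 * nP + 2)) :
  (forall i, (fun n => V n i 0) @ \oo --> v i 0) ->
  ((forall n, spectral_bound (V n)) -> spectral_bound v) /\
  (data_misfit \o V) @ \oo --> data_misfit v.
Proof.
move=> cV; split.
  move=> AV j.
  have cj := cvgD (cvg_sqr (cV (re_idx nD j))) (cvg_sqr (cV (im_idx nD j))).
  by apply: (cvgr_to_le (cj _)); near=> n; exact: AV.
rewrite /data_misfit; apply: (cvg_big (op := +%R)) => [|i _].
  exact: add_continuous.
by apply: cvg_sqr; apply: cvgB => //; exact: cvg_cst.
Unshelve. all: by end_near. Qed.

End DataFitProgram.

(** * The identification problem *)

Lemma fourier_sqr_le (R : realType) (T : time_kind) (w : R)
    (g : time_axis R T -> R) (c : R) :
  (`|fourier w g| ^+ 2 <= c%:C%C) =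
  (fourier_re w g ^+ 2 + fourier_im w g ^+ 2 <= c).
Proof. by rewrite -add_Re2_Im2 lecR. Qed.

(** Every position is a data index, or lies at an even or odd offset after the
    data indices, hence is the real or imaginary index of a frequency. *)
Lemma representer_family_in (R : realType) (T : time_kind)
    (H : hilbert_function_space R (time_axis R T))
    (u : time_line R T -> R) (nD nP : nat)
    (t : 'I_nD -> time_axis R T) (w : 'I_nP.+1 -> R)
    (phi : 'I_(nD + 2 * nP + 2) -> time_axis R T -> R) :
  representer_family H u t w phi -> forall i, H (phi i).
Proof.
move=> [data re im] i.
have [i_lt|i_ge] := ltnP i nD.
  have -> : i = data_idx nP (Ordinal i_lt) by exact/val_inj.
  by have [] := data (Ordinal i_lt).
have j_lt : ((i - nD)./2 < nP.+1)%N by have := ltn_ord i; lia.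
have [odd_i|even_i] := boolP (odd (i - nD)).
  have -> : i = im_idx nD (Ordinal j_lt) by apply/val_inj => /=; lia.
  by have [] := im (Ordinal j_lt).
have -> : i = re_idx nD (Ordinal j_lt) by apply/val_inj => /=; lia.
by have [] := re (Ordinal j_lt).
Qed.

Theorem theorem13 (R : realType) (T : time_kind)
  (k : time_axis R T -> time_axis R T -> R)
  (H : hilbert_function_space R (time_axis R T))
  (k_mercer : mercer_kernel k) (H_rkhs : is_rkhs k H)
  (k_stable : stable H) (mu0_fin : (mu0 k < +oo)%E)
  (u : time_line R T -> R) (u_bounded : bounded_input u)
  (nD : nat) (t : 'I_nD -> time_axis R T) (t_inj : injective t)
  (y : 'I_nD -> R)
  (lambda : R) (lambda_gt0 : 0 < lambda)
  (eps : R) (eps_gt0 : 0 < eps) (eps_lt1 : eps < 1)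
  (a b : R) (ab_Omega : `[a, b]%classic `<=` Omega R T)
  (nP : nat) (w : 'I_nP.+1 -> R) (w_partition : partition_of a b w)
  (phi : 'I_(nD + 2 * nP + 2) -> time_axis R T -> R)
  (phi_repr : representer_family H u t w phi)
  (phi_indep : lin_independent phi) :
  let Phi := gram H phi in
  convex_program (@finite_feasible R nD nP eps Phi)
    (finite_cost y lambda Phi) /\
  exists x : 'cV[R]_(nD + 2 * nP + 2),
    unique_solution (@finite_feasible R nD nP eps Phi)
      (finite_cost y lambda Phi) x /\
    unique_solution (hilbert_feasible H w eps)
      (hilbert_cost H u t y lambda) (lin_comb phi x).
Proof.
move=> Phi; have Hphi := representer_family_in phi_repr.
have [data re im] := phi_repr.
pose A := spectral_bound (nD := nD) (nP := nP) (1 - eps).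
pose Q := data_misfit (nP := nP) y.
have cAQ : convex_program A Q := data_fit_program_convex _ _ _.
have colE x i : ((col i Phi)^T *m x) 0 0 = (Phi *m x) i 0.
  by rewrite tr_col tr_gram // -row_mul mxE.
have feasE : finite_feasible eps Phi = coef_feasible H phi A.
  by apply/seteqP; split=> x Ax j; have := Ax j; rewrite !colE.
have costE : finite_cost y lambda Phi = coef_cost H phi Q lambda.
  by apply/funext => x; congr (_ + _); apply: eq_bigr => i _; rewrite colE.
have hfeasE : hilbert_feasible H w eps = reg_feasible H phi A.
  apply/seteqP; split=> g [Hg Ag]; split=> // j; have := Ag j;
  by rewrite fourier_sqr_le !mxE (re j).2 ?(im j).2.
have hcostE g : H g ->
    hilbert_cost H u t y lambda g = reg_cost H phi Q lambda g.
  move=> Hg; rewrite /hilbert_cost hnorm_sqr //; congr (_ + _).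
  by apply: eq_bigr => i _; rewrite mxE (data i).2.
rewrite feasE costE hfeasE; split; first exact: coef_program_convex (ltW _) _.
have [|v|V v cV|g g_sol] := reg_unique_solution (H := H) Hphi lambda_gt0 cAQ.
- by move=> j; rewrite !mxE expr0n addr0 subr_ge0 ltW.
- by apply: sumr_ge0 => i _; exact: sqr_ge0.
- exact: data_fit_program_closed.
have [x [x_sol gx]] := representer_theorem Hphi phi_indep lambda_gt0 g_sol.
exists x; split=> //; rewrite -gx.
have [[Fg Jg] g_uniq] := g_sol; have Hg := Fg.1.
split.
  by split=> // z Fz; have Hz := Fz.1; rewrite !hcostE //; exact: Jg.
move=> z [Fz Jz]; apply: g_uniq; split=> // f Ff.
have Hz := Fz.1; have Hf := Ff.1.
by rewrite -!hcostE //; exact: Jz.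
Qed.
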